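(* Let $T>0$, $n,m\ge1$, $0=t_0<t_1<\dots<t_m=T$, let $A$ be a continuous $(n\times n)$-matrix function on $[0,T]$, $K(t,\tau)$ a continuous $(n\times n)$-matrix function on $[0,T]\times[0,T]$, and $B_0,\dots,B_m$ constant $(n\times n)$ matrices. The problem $$\frac{dx}{dt}=A(t)x+\int_0^TK(t,\tau)x(\tau)\,d\tau+f(t),\quad t\in(0,T),\qquad \sum_{i=0}^mB_ix(t_i)=d$$ is well-posed if and only if there exist $\varepsilon>0$, $k\in\mathbb N$, continuous $(n\times n)$-matrix functions $\varphi_j,\psi_j$ ($j=1,\dots,k$) on $[0,T]$ satisfying $$\max_{t\in[0,T]}\int_0^T\Big\|K(t,\tau)-\sum_{j=1}^k\varphi_j(t)\psi_j(\tau)\Big\|\,d\tau<\varepsilon ,$$ and a constant $C_k$ such that the $\varepsilon$-approximating problem $$\frac{dx}{dt}=A(t)x+\sum_{j=1}^k\int_0^T\varphi_j(t)\psi_j(\tau)x(\tau)\,d\tau+f(t),\quad t\in(0,T),\qquad \sum_{i=0}^mB_ix(t_i)=d$$ is well-posed with constant $C_k$ and $C_k\cdot\varepsilon<1$.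
   Context: Norms: $\|x\|=\max_i|x_i|$ on $\mathbb R^n$, matrices carry the induced operator norm, $\|x\|_1=\max_{t\in[0,T]}\|x(t)\|$ for $x\in C([0,T],\mathbb R^n)$. A solution of either problem is a function $x:[0,T]\to\mathbb R^n$ that is continuous on $[0,T]$, continuously differentiable on $(0,T)$, and satisfies the integro-differential equation on $(0,T)$ and the multipoint condition. Either problem is well-posed (with constant $C$) if for every pair $(f,d)$ with $f\in C([0,T],\mathbb R^n)$, $d\in\mathbb R^n$, it has a unique solution $x$, and $\|x\|_1\le C\max(\|f\|_1,\|d\|)$, where $C$ is a constant independent of $f$ and $d$. *)

(* Defs.v *)
From HB Require Import structures.
From mathcomp Require Export all_boot all_order all_algebra.
From mathcomp Require Export all_classical all_reals all_analysis.
Export numFieldNormedType.Exports.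
Import Order.TTheory GRing.Theory Num.Theory.

Set Implicit Arguments.
Unset Strict Implicit.
Unset Printing Implicit Defensive.

Local Open Scope classical_set_scope.
Local Open Scope ring_scope.

(* Functions on [0, T] are represented by total functions on R of which only
   the values on [0, T] are ever used.  On 'cV[R]_n the library norm `|_| is
   the max norm; on 'M[R]_n it is the largest absolute value of an entry, which
   is not an operator norm, hence opnorm below. *)

Definition opnorm (R : realType) (n : nat) (M : 'M[R]_n) : R :=
  sup [set `|M *m v| | v in [set v : 'cV[R]_n | `|v| <= 1]].

(* For x continuous on [0, T] the supremum is attained. *)
Definition maxnorm (R : realType) (n : nat) (T : R) (x : R -> 'cV[R]_n) : R :=
  sup [set `|x t| | t in `[0, T]].

Definition vint (R : realType) (n : nat) (T : R) (g : R -> 'cV[R]_n) : 'cV[R]_n :=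
  \col_i \int[@lebesgue_measure R]_(s in `[0, T]) (g s i 0).

Definition kernel_term (R : realType) (n : nat) (T : R)
    (K : R -> R -> 'M[R]_n) (x : R -> 'cV[R]_n) (t : R) : 'cV[R]_n :=
  vint T (fun s => K t s *m x s).

Definition degenerate_term (R : realType) (n k : nat) (T : R)
    (phi psi : 'I_k -> R -> 'M[R]_n) (x : R -> 'cV[R]_n) (t : R) : 'cV[R]_n :=
  \sum_(j < k) vint T (fun s => phi j t *m psi j s *m x s).

(* Solutions of dx/dt = A(t) x + (I x)(t) + f(t) on (0, T),
   sum_i B_i x(t_i) = d, where I is the integral term of the equation. *)
Definition is_solution (R : realType) (n m : nat) (T : R)
    (tt : 'I_m.+1 -> R) (B : 'I_m.+1 -> 'M[R]_n) (A : R -> 'M[R]_n)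
    (I : (R -> 'cV[R]_n) -> R -> 'cV[R]_n)
    (f : R -> 'cV[R]_n) (d : 'cV[R]_n) (x : R -> 'cV[R]_n) : Prop :=
  [/\ {within `[0, T], continuous x},
      forall t, t \in `]0, T[ -> derivable x t 1,
      {within `]0, T[, continuous (derive1 x)},
      forall t, t \in `]0, T[ -> derive1 x t = A t *m x t + I x t + f t
    & \sum_(i < m.+1) B i *m x (tt i) = d].

Definition well_posed_with (R : realType) (n m : nat) (T : R)
    (tt : 'I_m.+1 -> R) (B : 'I_m.+1 -> 'M[R]_n) (A : R -> 'M[R]_n)
    (I : (R -> 'cV[R]_n) -> R -> 'cV[R]_n) (C : R) : Prop :=
  forall (f : R -> 'cV[R]_n) (d : 'cV[R]_n),
    {within `[0, T], continuous f} ->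
    exists x : R -> 'cV[R]_n,
      [/\ is_solution T tt B A I f d x,
          forall y, is_solution T tt B A I f d y -> {in `[0, T], y =1 x}
        & maxnorm T x <= C * Num.max (maxnorm T f) `|d|].

Definition well_posed (R : realType) (n m : nat) (T : R)
    (tt : 'I_m.+1 -> R) (B : 'I_m.+1 -> 'M[R]_n) (A : R -> 'M[R]_n)
    (I : (R -> 'cV[R]_n) -> R -> 'cV[R]_n) : Prop :=
  exists C : R, well_posed_with T tt B A I C.

(* max over t in [0, T] of int_0^T || K(t,s) - sum_j phi_j(t) psi_j(s) || ds;
   for continuous data the integral is continuous in t, so the supremum is
   attained. *)
Definition kernel_distance (R : realType) (n k : nat) (T : R)
    (K : R -> R -> 'M[R]_n) (phi psi : 'I_k -> R -> 'M[R]_n) : R :=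
  sup [set \int[@lebesgue_measure R]_(s in `[0, T])
             opnorm (K t s - \sum_(j < k) phi j t *m psi j s) | t in `[0, T]].

(* Main.v *)
Require Import Defs.
From mathcomp Require Import ring lra.
Import Order.TTheory GRing.Theory Num.Theory.
Local Open Scope classical_set_scope.
Local Open Scope ring_scope.

(* Well-posedness is stable under small perturbations of the kernel: if the
   problem with kernel K1 is well-posed with constant C and K2 is within delta
   of K1, with C * delta < 1, then the map sending x to the K1-solution with
   right-hand side f + (K2 - K1) x is a contraction of factor C * delta in the
   max norm.  Its fixed point is the unique K2-solution, and the problem for K2
   is well-posed with constant C / (1 - C * delta).  One implication is the
   passage from the degenerate kernel to K.  For the other, uniform continuity
   of K and a partition of unity (a_j) subordinate to a fine grid (p_j) make
   sum_j a_j(t) K(p_j, s) uniformly close to K, and C / (1 - C * delta) stays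
   bounded as delta tends to 0. *)

Set Implicit Arguments.
Unset Strict Implicit.
Unset Printing Implicit Defensive.

(** * Continuity relative to a set, and the entrywise max norm of matrices *)

Lemma compact_unif_continuous (R : realType) (X : pseudoMetricType R)
    (V : normedModType R) (D : set X) (f : X -> V) :
  compact D -> {within D, continuous f} ->
  forall e : R, 0 < e -> exists2 d : R, 0 < d &
    forall x y, D x -> D y -> ball x d y -> `|f x - f y| < e.
Proof.
move=> /compact_near_coveringP cD /subspace_continuousP cf e e0.
(* The premise [D x] sits inside [P] because the near-covering property ranges over full
   neighbourhoods, whose points may lie outside [D]. Half the radius of continuity at [x] then
   serves all nearby [x'] at once. *)
pose P d x := D x -> forall y, D y -> ball x d y -> `|f x - f y| < e.
have F0 : Filter (0^'+ : set_system R) by exact: filter_filter.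
suff : \forall d \near 0^'+, D `<=` P d.
  move=> H; have [d [d0 dP]] := @filter_ex _ _ _ _
    (filterI H (nbhs_right_gt (0 : R))).
  by exists d => // x y Dx Dy; apply: d0.
apply: cD => x Dx.
have /cvgrPdist_lt/(_ (e / 2)) := cf x Dx.
rewrite divr_gt0// => /(_ isT); rewrite near_withinE.
move=> /nbhs_ballP[r /= r0 rP].
exists (ball x (r / 2), [set d | 0 < d < r / 2]).
  split; first by apply: nbhsx_ballx; rewrite divr_gt0.
  by near=> d => /=; apply/andP; split; near: d;
    [exact: nbhs_right_gt | apply: nbhs_right_lt; rewrite divr_gt0].
move=> [x' d] [/= xx' /andP[d0 dr]] Dx' y Dy x'y.
rewrite -(subrKA (f x)) (le_lt_trans (ler_normD _ _))// (splitr e) ltrD//.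
- rewrite distrC rP//; apply: le_ball xx'; rewrite ler_pdivrMr//; lra.
- rewrite rP// (splitr r); apply: ball_triangle xx' _.
  exact: le_ball (ltW dr) _ x'y.
Unshelve. all: by end_near. Qed.

Lemma within_continuousP (R : realType) (X : pseudoMetricType R)
    (V : normedModType R) (D : set X) (f : X -> V) :
  {within D, continuous f} <->
  (forall x (e : R), D x -> 0 < e -> exists2 d : R, 0 < d &
    forall y, D y -> ball x d y -> `|f x - f y| < e).
Proof.
split=> [/subspace_continuousP cf x e Dx e0|H].
  have /cvgrPdist_lt/(_ e e0) := cf x Dx.
  rewrite near_withinE => /nbhs_ballP[d /= d0 dP]; exists d => // y Dy xy.
  exact: dP.
apply/subspace_continuousP => x Dx; apply/cvgrPdist_lt => e e0.
have [d d0 dP] := H x e Dx e0.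
by rewrite near_withinE; apply/nbhs_ballP; exists d => //= y xy Dy; exact: dP.
Qed.

Lemma mx_norm_entry (R : realType) m n (M : 'M[R]_(m, n)) i j :
  `|M i j| <= `|M|.
Proof.
by rewrite [leRHS]/Num.norm/= mx_normrE; apply/bigmax_geP; right; exists (i, j).
Qed.

Lemma mx_norm_le (R : realType) m n (M : 'M[R]_(m, n)) c :
  0 <= c -> (forall i j, `|M i j| <= c) -> `|M| <= c.
Proof.
by move=> c0 H; rewrite [leLHS]/Num.norm/= mx_normrE; apply/bigmax_leP; split.
Qed.

(** Each entry of the product is a sum of [n] products of entries; hence the factor [n%:R], as the
    entrywise max norm is not submultiplicative in general. *)
Lemma mx_norm_mul (R : realType) m n p (M : 'M[R]_(m, n)) (N : 'M[R]_(n, p)) :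
  `|M *m N| <= n%:R * `|M| * `|N|.
Proof.
apply: mx_norm_le => [|i j]; first by rewrite !mulr_ge0.
rewrite mxE (le_trans (ler_norm_sum _ _ _))//.
rewrite (le_trans (_ : _ <= \sum_(k < n) `|M| * `|N|))//.
  by apply: ler_sum => k _; rewrite normrM ler_pM// mx_norm_entry.
by rewrite sumr_const card_ord -mulrA mulr_natl.
Qed.

Lemma within_continuous_entry (R : realType) (X : pseudoMetricType R) (D : set X)
    m n (F : X -> 'M[R]_(m, n)) i j :
  {within D, continuous F} -> {within D, continuous (fun x => F x i j)}.
Proof.
move=> /within_continuousP cF; apply/(@within_continuousP R X R^o) => x e Dx e0.
have [d d0 dP] := cF x e Dx e0; exists d => // y Dy xy.
by rewrite (le_lt_trans _ (dP y Dy xy))// (le_trans _ (mx_norm_entry _ i j))// !mxE.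
Qed.

Lemma within_continuous_mulmx (R : realType) (X : pseudoMetricType R) (D : set X)
    m n p (F : X -> 'M[R]_(m, n)) (G : X -> 'M[R]_(n, p)) :
  {within D, continuous F} -> {within D, continuous G} ->
  {within D, continuous (fun x => F x *m G x)}.
Proof.
move=> /within_continuousP cF /within_continuousP cG.
apply/within_continuousP => x e Dx e0.
(* With both increments below [s <= 1], the splitting [F x *m (G x - G y) + (F x - F y) *m G y] is
   bounded by [s * (c - 1)]. The extra 1 in [c] makes [c] positive and the final inequality
   strict. *)
pose c := n%:R * (`|F x| + `|G x| + 1) + 1.
have c0 : 0 < c by rewrite ltr_pwDr// mulr_ge0// !addr_ge0.
pose s := Num.min 1 (e / c).
have s0 : 0 < s by rewrite lt_min ltr01 divr_gt0.
have [d1 d10 d1P] := cF x s Dx s0.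
have [d2 d20 d2P] := cG x s Dx s0.
exists (Num.min d1 d2) => [|y Dy xy]; first by rewrite lt_min d10.
have Fxy : `|F x - F y| < s.
  by apply: d1P => //; apply: le_ball xy; rewrite ge_min lexx.
have Gxy : `|G x - G y| < s.
  by apply: d2P => //; apply: le_ball xy; rewrite ge_min lexx orbT.
have Gy : `|G y| <= `|G x| + 1.
  have -> : G y = G x - (G x - G y) by rewrite subKr.
  rewrite (le_trans (ler_normB _ _))// lerD2l (le_trans (ltW Gxy))//.
  by rewrite ge_min lexx.
have -> : F x *m G x - F y *m G y = (F x) *m (G x - G y) + (F x - F y) *m G y.
  by rewrite mulmxBr mulmxBl subrKA.
have sc : s * c <= e by rewrite -ler_pdivlMr// ge_min lexx orbT.
apply: lt_le_trans sc.
rewrite (le_lt_trans (ler_normD _ _))//.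
rewrite (le_lt_trans (lerD (mx_norm_mul _ _) (mx_norm_mul _ _)))//.
apply: (@le_lt_trans _ _ (n%:R * `|F x| * s + n%:R * s * (`|G x| + 1))).
  apply: lerD; first by rewrite ler_wpM2l ?mulr_ge0// ltW.
  by rewrite ler_pM ?mulr_ge0// ler_wpM2l// ltW.
rewrite (_ : _ + _ = s * (c - 1)); last by rewrite /c; ring.
by rewrite ltr_pM2l// ltrBlDr ltrDl.
Qed.

(** * The operator norm induced by the max norm, and its comparison with the entrywise norm *)

Section opnorm.
Context {R : realType} {n : nat}.
Implicit Types (M N : 'M[R]_n) (v : 'cV[R]_n).

Lemma opnorm_has_sup M :
  has_sup [set `|M *m v| | v in [set v : 'cV[R]_n | `|v| <= 1]].
Proof.
split; first by exists `|M *m (0 : 'cV[R]_n)|, 0 => //=; rewrite normr0.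
exists (n%:R * `|M|) => _ [v /= v1 <-].
by rewrite (le_trans (mx_norm_mul _ _))// ler_piMr// mulr_ge0.
Qed.

Lemma opnorm_le M c : (forall v, `|v| <= 1 -> `|M *m v| <= c) -> opnorm M <= c.
Proof.
by move=> H; apply: ge_sup => [|_ [v /= v1 <-]]; [case: (opnorm_has_sup M)|exact: H].
Qed.

Lemma le_opnorm M v : `|v| <= 1 -> `|M *m v| <= opnorm M.
Proof. by move=> v1; apply: ub_le_sup; [case: (opnorm_has_sup M)|exists v]. Qed.

Lemma opnorm_ge0 M : 0 <= opnorm M.
Proof. by rewrite (le_trans _ (@le_opnorm M 0 _))// normr0. Qed.

Lemma norm_mulmx_opnorm M v : `|M *m v| <= opnorm M * `|v|.
Proof.
have [->|v0] := eqVneq v 0; first by rewrite mulmx0 !normr0 mulr0.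
have nv0 : 0 < `|v| by rewrite normr_gt0.
have -> : v = `|v| *: (`|v|^-1 *: v) by rewrite scalerA divff ?scale1r// gt_eqF.
rewrite -scalemxAr !normrZ normr_id normfV normr_id mulVf ?gt_eqF// mulr1 mulrC.
rewrite ler_pM2r//; apply: le_opnorm.
by rewrite normrZ normfV normr_id mulVf// gt_eqF.
Qed.

Lemma opnorm_le_mx_norm M : opnorm M <= n%:R * `|M|.
Proof.
apply: opnorm_le => v v1.
by rewrite (le_trans (mx_norm_mul _ _))// ler_piMr// mulr_ge0.
Qed.

Lemma opnormN M : opnorm (- M) = opnorm M.
Proof.
rewrite /opnorm; congr sup; apply/seteqP; split => _ [v /= v1 <-];
  by exists v => //; rewrite mulNmx normrN.
Qed.

Lemma ler_opnormD M N : opnorm (M + N) <= opnorm M + opnorm N.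
Proof.
apply: opnorm_le => v v1; rewrite mulmxDl (le_trans (ler_normD _ _))//.
by rewrite lerD// le_opnorm.
Qed.

(** Follows from subadditivity and the bound of [opnorm] by [n%:R] times the entrywise norm. It
    makes [opnorm] continuous, so that the integrands in [kernel_distance] are continuous for
    continuous data. *)
Lemma opnorm_lipschitz M N : `|opnorm M - opnorm N| <= n%:R * `|M - N|.
Proof.
have sub (P Q : 'M[R]_n) : opnorm P - opnorm Q <= n%:R * `|P - Q|.
  rewrite lerBlDr (le_trans _ (lerD (opnorm_le_mx_norm (P - Q)) (lexx _)))//.
  by rewrite -[X in opnorm X <= _](subrK Q) ler_opnormD.
by rewrite ler_norml sub lerNl opprB distrC sub.
Qed.

End opnorm.

Lemma within_continuous_opnorm (R : realType) (X : pseudoMetricType R) (D : set X)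
    n (F : X -> 'M[R]_n) :
  {within D, continuous F} -> {within D, continuous (fun x => opnorm (F x))}.
Proof.
move=> /within_continuousP cF; apply/(@within_continuousP R X R^o) => x e Dx e0.
(* Dividing by [n%:R + 1] instead of the Lipschitz constant [n%:R] also covers [n = 0]. *)
have c0 : 0 < n%:R + 1 :> R by rewrite ltr_wpDl.
have [d d0 dP] := cF x (e / (n%:R + 1)) Dx (divr_gt0 e0 c0); exists d => // y Dy xy.
rewrite (le_lt_trans (opnorm_lipschitz _ _))//.
rewrite (@le_lt_trans _ _ ((n%:R + 1) * `|F x - F y|))//.
  by rewrite ler_wpM2r// lerDl.
by rewrite mulrC -ltr_pdivlMr// dP.
Qed.

(** * The max norm of vector functions on the segment *)

Section maxnorm.
Context {R : realType} {n : nat} (T : R).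
Implicit Types x : R -> 'cV[R]_n.

(** Continuity on a compact segment bounds the set of values; for an unbounded set, [sup] would
    carry no information. *)
Lemma le_maxnorm x t : {within `[0, T], continuous x} ->
  t \in `[0, T] -> `|x t| <= maxnorm T x.
Proof.
move=> cx tT; apply: ub_le_sup; last by exists t.
have [M [_ MP]] := compact_bounded (continuous_compact cx (@segment_compact _ 0 T)).
by exists (M + 1) => _ [s sT <-]; apply: MP; [rewrite ltrDl|exists s].
Qed.

Lemma maxnorm_le x c : 0 <= T ->
  (forall t, t \in `[0, T] -> `|x t| <= c) -> maxnorm T x <= c.
Proof.
move=> T0 H; apply: ge_sup => [|_ [t tT <-]]; last exact: H.
by exists `|x 0|, 0 => //=; rewrite in_itv/= lexx.
Qed.

Lemma maxnorm_ge0 x : 0 <= T -> {within `[0, T], continuous x} -> 0 <= maxnorm T x.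
Proof.
move=> T0 cx; rewrite (le_trans (normr_ge0 (x 0)))// le_maxnorm//.
by rewrite in_itv/= lexx.
Qed.

Lemma eq_maxnorm x y : {in `[0, T], x =1 y} -> maxnorm T x = maxnorm T y.
Proof.
move=> xy; rewrite /maxnorm; congr sup; apply/seteqP.
by split => _ [t tT <-]; exists t => //; rewrite xy.
Qed.

Lemma maxnorm_cst (v : 'cV[R]_n) : 0 <= T -> maxnorm T (cst v) = `|v|.
Proof.
move=> T0; apply/eqP; rewrite eq_le; apply/andP; split.
  by apply: maxnorm_le.
have := @le_maxnorm (cst v) 0; apply; last by rewrite in_itv/= lexx.
exact/continuous_subspaceT/cst_continuous.
Qed.

Lemma maxnormD x y : 0 <= T ->
  {within `[0, T], continuous x} -> {within `[0, T], continuous y} ->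
  maxnorm T (x + y) <= maxnorm T x + maxnorm T y.
Proof.
move=> T0 cx cy; apply: maxnorm_le => // t tT.
by rewrite (le_trans (ler_normD _ _))// lerD// le_maxnorm.
Qed.

End maxnorm.

(** * Entrywise integrals of vector functions over the segment *)

Section vint.
Context {R : realType} (T : R).
Hypothesis T0 : 0 <= T.
Notation mu := (@lebesgue_measure R).

Lemma within_continuous_integrable (f : R -> R) :
  {within `[0, T], continuous f} -> mu.-integrable `[0, T] (EFin \o f).
Proof. exact/continuous_compact_integrable/segment_compact. Qed.

Lemma Rintegral_itv_le (f : R -> R) c : {within `[0, T], continuous f} ->
  (forall t, t \in `[0, T] -> f t <= c) -> \int[mu]_(t in `[0, T]) f t <= c * T.
Proof.
move=> cf fc.
have -> : c * T = \int[mu]_(t in `[0, T]) c.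
  have := @Rintegral_cst _ _ R mu `[0, T]%classic (measurable_itv _) c => ->.
  rewrite [X in fine X](lebesgue_measure_itv `[0, T])/= lte_fin.
  by case: ltgtP T0 => //= [_|<-]; rewrite ?oppr0 ?addr0.
apply: le_Rintegral => //; apply: within_continuous_integrable => //.
exact/continuous_subspaceT/cst_continuous.
Qed.

Lemma vintB n (f g : R -> 'cV[R]_n) :
  {within `[0, T], continuous f} -> {within `[0, T], continuous g} ->
  vint T (fun s => f s - g s) = vint T f - vint T g.
Proof.
move=> cf cg; apply/colP => i; rewrite !mxE -RintegralB//.
- by apply: eq_Rintegral => s _; rewrite !mxE.
- exact/within_continuous_integrable/within_continuous_entry.
- exact/within_continuous_integrable/within_continuous_entry.
Qed.

Lemma vint0 n : vint T (fun=> 0 : 'cV[R]_n) = 0.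
Proof.
apply/colP => i; rewrite !mxE.
by rewrite Rintegral_cst// mul0r.
Qed.

Lemma vintD n (f g : R -> 'cV[R]_n) :
  {within `[0, T], continuous f} -> {within `[0, T], continuous g} ->
  vint T (fun s => f s + g s) = vint T f + vint T g.
Proof.
move=> cf cg; apply/colP => i; rewrite !mxE -RintegralD//.
- by apply: eq_Rintegral => s _; rewrite !mxE.
- exact/within_continuous_integrable/within_continuous_entry.
- exact/within_continuous_integrable/within_continuous_entry.
Qed.

Lemma eq_vint n (f g : R -> 'cV[R]_n) : {in `[0, T], f =1 g} -> vint T f = vint T g.
Proof.
move=> fg; apply/colP => i; rewrite !mxE; apply: eq_Rintegral => s.
by rewrite inE => sT; rewrite fg.
Qed.

(** For the max norm it suffices to bound each entry of the integral, and each entry of [f] is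
    dominated by [g]; no constant depending on [n] is lost. *)
Lemma norm_vint_le n (f : R -> 'cV[R]_n) (g : R -> R) :
  {within `[0, T], continuous f} -> {within `[0, T], continuous g} ->
  (forall t, t \in `[0, T] -> `|f t| <= g t) ->
  `|vint T f| <= \int[mu]_(t in `[0, T]) g t.
Proof.
move=> cf cg fg; apply: mx_norm_le => [|i j].
  apply: Rintegral_ge0 => t tT; exact: le_trans (fg _ tT).
have cfi : {within `[0, T], continuous (fun s => f s i 0)}.
  exact: within_continuous_entry.
rewrite !mxE (le_trans (le_normr_Rintegral _ _))//.
  exact: within_continuous_integrable.
apply: le_Rintegral => //.
- apply: within_continuous_integrable => t.
  by apply: (@cvg_norm _ R^o); apply: cfi.
- exact: within_continuous_integrable.
- by move=> t tT; rewrite (le_trans (mx_norm_entry _ _ _))// fg.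
Qed.

End vint.

Lemma within_continuous_sum (R : realType) (X : topologicalType) (D : set X)
    (V : normedModType R) (I : Type) (r : seq I) (F : I -> X -> V) :
  (forall i, {within D, continuous (F i)}) ->
  {within D, continuous (fun x => \sum_(i <- r) F i x)}.
Proof.
move=> cF; elim: r => [|i r IHr].
  rewrite (_ : (fun _ => _) = cst 0); last by apply/funext => x; rewrite big_nil.
  exact/continuous_subspaceT/cst_continuous.
rewrite (_ : (fun _ => _) = F i + (fun x => \sum_(j <- r) F j x)).
  exact: within_continuousD.
by apply/funext => x; rewrite big_cons.
Qed.

(** * Integral operators with continuous kernels *)

Section kernels.
Context {R : realType} {n : nat} (T : R).
Hypothesis T0 : 0 <= T.
Notation mu := (@lebesgue_measure R).
Implicit Types (K L : R -> R -> 'M[R]_n) (x y : R -> 'cV[R]_n).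

Definition continuous_kernel K :=
  {within `[0, T] `*` `[0, T], continuous (fun p : R * R => K p.1 p.2)}.

Lemma continuous_kernel_section K t : continuous_kernel K -> t \in `[0, T] ->
  {within `[0, T], continuous (K t)}.
Proof.
move=> /within_continuousP cK tT; apply/within_continuousP => s e sT e0.
have [d d0 dP] := cK (t, s) e (conj tT sT) e0; exists d => // s' s'T ss'.
exact: (dP (t, s') (conj tT s'T) (conj (ballxx _ d0) ss')).
Qed.

Lemma continuous_kernelB K L : continuous_kernel K -> continuous_kernel L ->
  continuous_kernel (fun t s => K t s - L t s).
Proof. exact: within_continuousB. Qed.

(** Integrates the pointwise operator norm inequality. It turns a bound on the integrated distance
    of two kernels into a bound on the difference of the integral operators in the max norm. *)
Lemma norm_vint_mulmx (L : R -> 'M[R]_n) x :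
  {within `[0, T], continuous L} -> {within `[0, T], continuous x} ->
  `|vint T (fun s => L s *m x s)| <=
    (\int[mu]_(s in `[0, T]) opnorm (L s)) * maxnorm T x.
Proof.
move=> cL cx; have co := within_continuous_opnorm cL.
rewrite -RintegralZr//; last exact: within_continuous_integrable.
apply: norm_vint_le => //.
- exact: within_continuous_mulmx.
- by move=> s; apply: (@cvgM _ _ _ _ (_ : _ -> R)); [exact: co|exact: cvg_cst].
- move=> s sT; rewrite (le_trans (norm_mulmx_opnorm _ _))//.
  by rewrite ler_wpM2l ?opnorm_ge0// le_maxnorm.
Qed.

Lemma kernel_termB K x y t : continuous_kernel K -> t \in `[0, T] ->
  {within `[0, T], continuous x} -> {within `[0, T], continuous y} ->
  kernel_term T K (x - y) t = kernel_term T K x t - kernel_term T K y t.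
Proof.
move=> cK tT cx cy; have cKt := continuous_kernel_section cK tT.
rewrite /kernel_term -vintB//; [|exact: within_continuous_mulmx..].
by apply: eq_vint => s _; rewrite -mulmxBr.
Qed.

Lemma kernel_term_kernelB K L x t :
  continuous_kernel K -> continuous_kernel L -> t \in `[0, T] ->
  {within `[0, T], continuous x} ->
  kernel_term T (fun t s => K t s - L t s) x t =
  kernel_term T K x t - kernel_term T L x t.
Proof.
move=> cK cL tT cx; rewrite /kernel_term -vintB.
- by apply: eq_vint => s _; rewrite mulmxBl.
- by apply: within_continuous_mulmx => //; exact: continuous_kernel_section.
- by apply: within_continuous_mulmx => //; exact: continuous_kernel_section.
Qed.

Lemma eq_kernel_term K x y t : {in `[0, T], x =1 y} ->
  kernel_term T K x t = kernel_term T K y t.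
Proof. by move=> xy; apply: eq_vint => s sT; rewrite xy. Qed.

Lemma kernel_term_continuous K x : continuous_kernel K ->
  {within `[0, T], continuous x} -> {within `[0, T], continuous (kernel_term T K x)}.
Proof.
move=> cK cx; apply/within_continuousP => t e tT e0.
(* Uniform continuity of [K] with tolerance [e / c] bounds the difference by
   [n%:R * (e / c) * T * maxnorm T x], which is [e * ((c - 1) / c)] and thus below [e]. *)
pose c := n%:R * T * maxnorm T x + 1.
have c0 : 0 < c by rewrite ltr_pwDr// !mulr_ge0// maxnorm_ge0.
have cD : compact (`[0, T] `*` `[0, T] : set (R * R)).
  by apply: compact_setX; exact: segment_compact.
have [d d0 dP] := compact_unif_continuous cD cK (divr_gt0 e0 c0).
exists d => // t' t'T tt'.
have cKt := continuous_kernel_section cK tT.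
have cKt' := continuous_kernel_section cK t'T.
have cL : {within `[0, T], continuous (K t - K t')} by exact: within_continuousB.
have -> : kernel_term T K x t - kernel_term T K x t' =
    vint T (fun s => (K t - K t') s *m x s).
  rewrite /kernel_term -vintB//; [|exact: within_continuous_mulmx..].
  by apply: eq_vint => s _; rewrite -mulmxBl.
rewrite (le_lt_trans (norm_vint_mulmx cL cx))//.
apply: (@le_lt_trans _ _ (n%:R * (e / c) * T * maxnorm T x)).
  rewrite ler_wpM2r ?maxnorm_ge0// Rintegral_itv_le//.
    exact: within_continuous_opnorm.
  move=> s sT; rewrite (le_trans (opnorm_le_mx_norm _))// ler_wpM2l// ltW//.
  by apply: (dP (t, s) (t', s)) => //; split => //=; exact: ballxx.
rewrite (_ : _ * _ = e * ((c - 1) / c)); last by rewrite /c; ring.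
by rewrite gtr_pMr// ltr_pdivrMr// mul1r ltrBlDr ltrDl.
Qed.

(** [opnorm] of the kernel is bounded on the compact square. This ensures that the supremum in
    [kernel_distance] is taken over a bounded set and dominates each integral. *)
Lemma Rintegral_opnorm_bounded K : continuous_kernel K ->
  exists M, forall t, t \in `[0, T] -> \int[mu]_(s in `[0, T]) opnorm (K t s) <= M.
Proof.
move=> cK.
have cD : compact (`[0, T] `*` `[0, T] : set (R * R)).
  by apply: compact_setX; exact: segment_compact.
have [M [_ MP]] := compact_bounded (continuous_compact (within_continuous_opnorm cK) cD).
exists ((M + 1) * T) => t tT; apply: Rintegral_itv_le => //.
  exact/within_continuous_opnorm/continuous_kernel_section.
move=> s sT; rewrite (le_trans (ler_norm _))//; apply: MP; first by rewrite ltrDl.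
by exists (t, s).
Qed.

(** * Degenerate kernels as a special case of continuous kernels *)

Section degenerate.
Context {k : nat} (phi psi : 'I_k -> R -> 'M[R]_n).
Hypotheses (cphi : forall j, {within `[0, T], continuous (phi j)})
  (cpsi : forall j, {within `[0, T], continuous (psi j)}).

Lemma degenerate_kernel_continuous :
  continuous_kernel (fun t s => \sum_(j < k) phi j t *m psi j s).
Proof.
apply: within_continuous_sum => j; apply: within_continuous_mulmx.
- apply/within_continuousP => -[t s] e [tT sT] e0.
  have /within_continuousP/(_ t e tT e0)[d d0 dP] := @cphi j.
  by exists d => // -[t' s'] [t'T _] [tt' _]; exact: dP.
- apply/within_continuousP => -[t s] e [tT sT] e0.
  have /within_continuousP/(_ s e sT e0)[d d0 dP] := @cpsi j.
  by exists d => // -[t' s'] [_ s'T] [_ ss']; exact: dP.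
Qed.

(** The finite sum is exchanged with the integral, so that the approximating problem becomes one
    with a single continuous kernel, to which the perturbation result applies. *)
Lemma degenerate_termE x t : t \in `[0, T] -> {within `[0, T], continuous x} ->
  degenerate_term T phi psi x t =
  kernel_term T (fun t s => \sum_(j < k) phi j t *m psi j s) x t.
Proof.
move=> tT cx; rewrite /degenerate_term /kernel_term.
pose F j s := phi j t *m psi j s *m x s.
have cF j : {within `[0, T], continuous (F j)}.
  apply: within_continuous_mulmx => //; apply: within_continuous_mulmx => //.
  exact/continuous_subspaceT/cst_continuous.
rewrite [RHS](@eq_vint _ _ _ _ (fun s => \sum_(j < k) F j s)); last first.
  by move=> s _; rewrite mulmx_suml.
elim: (index_enum _) => [|j r IHr].
  rewrite big_nil (@eq_vint _ _ _ _ (fun=> 0)) ?vint0// => s _.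
  by rewrite big_nil.
rewrite big_cons IHr -vintD; [|exact: (cF j)|exact: within_continuous_sum].
by apply: eq_vint => s _; rewrite big_cons.
Qed.

Lemma le_kernel_distance K t : continuous_kernel K -> t \in `[0, T] ->
  \int[mu]_(s in `[0, T]) opnorm (K t s - \sum_(j < k) phi j t *m psi j s)
    <= kernel_distance T K phi psi.
Proof.
move=> cK tT; apply: ub_le_sup; last by exists t.
have [M MP] := Rintegral_opnorm_bounded
  (continuous_kernelB cK degenerate_kernel_continuous).
by exists M => _ [s sT <-]; exact: MP.
Qed.

End degenerate.

(** The Banach fixed point theorem, by Picard iteration from 0: the iterates converge uniformly on
    [[0, T]] at a geometric rate, so the limit is continuous there. As [maxnorm] sees only values on
    [[0, T]], the fixed point equation is asserted only there. *)
Lemma sup_contraction_fixpoint (Phi : (R -> 'cV[R]_n) -> R -> 'cV[R]_n) (q : R) :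
  0 <= q < 1 ->
  (forall x, {within `[0, T], continuous x} -> {within `[0, T], continuous (Phi x)}) ->
  (forall x y, {within `[0, T], continuous x} -> {within `[0, T], continuous y} ->
    maxnorm T (Phi x - Phi y) <= q * maxnorm T (x - y)) ->
  exists2 x, {within `[0, T], continuous x} & {in `[0, T], Phi x =1 x}.
Proof.
move=> /andP[q0 q1] cPhi lipPhi.
pose u := fix u k := if k is k'.+1 then Phi (u k') else cst 0.
have cu k : {within `[0, T], continuous (u k)}.
  elim: k => [|k IHk] /=; last exact: cPhi.
  exact/continuous_subspaceT/cst_continuous.
pose M := maxnorm T (u 1%N - u 0%N).
have M0 : 0 <= M by rewrite maxnorm_ge0//; exact: within_continuousB.
have step k : maxnorm T (u k.+1 - u k) <= q ^+ k * M.
  elim: k => [|k IHk]; first by rewrite expr0 mul1r.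
  apply: (le_trans (lipPhi _ _ (cu k.+1) (cu k))); by rewrite exprS -mulrA ler_wpM2l.
(* [b k] is the tail of the geometric series with terms [q ^+ j * M], [j >= k]. It bounds the
   distance from [u k] to all later iterates, and by passage to the limit also to [x]. *)
pose b k := q ^+ k * (M / (1 - q)).
have b0 k : 0 <= b k by rewrite !mulr_ge0 ?exprn_ge0// invr_ge0 subr_ge0 ltW.
have bS k : q ^+ k * M + b k.+1 = b k.
  by rewrite /b exprS; field; rewrite subr_eq0 gt_eqF.
have bnd k m t : t \in `[0, T] -> `|u (k + m)%N t - u k t| <= b k.
  move=> tT; elim: m k => [|m IHm] k; first by rewrite addn0 subrr normr0.
  rewrite addnS -addSn -(subrKA (u k.+1 t)) (le_trans (ler_normD _ _))//.
  rewrite addrC -bS lerD// (le_trans _ (step k))//.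
  by apply: (@le_maxnorm _ _ _ (u k.+1 - u k)) => //; exact: within_continuousB.
have bcvg : b @ \oo --> (0 : R).
  rewrite -[X in _ --> X](mul0r (M / (1 - q))); apply: cvgMr_tmp.
  by apply: cvg_expr; rewrite ger0_norm.
have ucvg t : t \in `[0, T] -> cvg (u k t @[k --> \oo]).
  move=> tT; apply/cauchy_cvgP/cauchy_exP => e e0.
  have /cvgrPdist_lt/(_ e e0)[k _ /(_ k (leqnn k))] := bcvg.
  rewrite sub0r normrN ger0_norm// => bk.
  exists (u k t), k => // m /= km; rewrite -ball_normE/= distrC.
  by rewrite -(subnKC km) (le_lt_trans _ bk)// bnd.
pose x t := lim (u k t @[k --> \oo]).
have xu k t : t \in `[0, T] -> `|x t - u k t| <= b k.
  move=> tT; apply/ler_addgt0Pr => e e0.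
  have /cvgrPdist_lt/(_ e e0)[m _ mP] := ucvg t tT.
  have /mP mk : (m <= k + m)%N by rewrite leq_addl.
  by rewrite -(subrKA (u (k + m)%N t)) addrC (le_trans (ler_normD _ _))// lerD ?bnd// ltW.
have cx : {within `[0, T], continuous x}.
  apply/within_continuousP => t e tT e0.
  have e3 : 0 < e / 3 by rewrite divr_gt0.
  have /cvgrPdist_lt/(_ (e / 3) e3)[k _ /(_ k (leqnn k))] := bcvg.
  rewrite sub0r normrN ger0_norm// => bk.
  have /within_continuousP/(_ t (e / 3) tT e3)[d d0 dP] := cu k.
  exists d => // s sT ts; have := dP s sT ts.
  have xt := le_lt_trans (xu k t tT) bk; have xs := le_lt_trans (xu k s sT) bk.
  have -> : x t - x s = (x t - u k t) + (u k t - u k s) - (x s - u k s).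
    by rewrite subrKA opprB addrA subrK.
  have := ler_normD (x t - u k t) (u k t - u k s).
  have := ler_normB (x t - u k t + (u k t - u k s)) (x s - u k s).
  lra.
(* [Phi x] is compared with [x] through [u k.+1], which is [Phi (u k)]: both distances are below
   [e / 2] for large [k]. *)
exists x => // t tT; apply/eqP; rewrite -subr_eq0 -normr_le0.
apply/ler_addgt0Pr => e e0; rewrite add0r.
have e2 : 0 < e / 2 by rewrite divr_gt0.
have /cvgrPdist_lt/(_ (e / 2) e2)[k _ kP] := bcvg.
have := kP k (leqnn k); have := kP k.+1 (leqnSn k).
rewrite /= !sub0r !normrN !ger0_norm// => bk1 bk.
rewrite -(subrKA (u k.+1 t)) (le_trans (ler_normD _ _))// (splitr e) lerD//.
  apply: (@le_trans _ _ (maxnorm T (Phi x - Phi (u k)))).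
    apply: (@le_maxnorm _ _ _ (Phi x - Phi (u k))) => //.
    by apply: within_continuousB; exact: cPhi.
  rewrite (le_trans (lipPhi _ _ cx (cu k)))// (le_trans _ (ltW bk))//.
  rewrite (@le_trans _ _ (maxnorm T (x - u k)))//.
    by rewrite ler_piMl ?(ltW q1)// maxnorm_ge0//; exact: within_continuousB.
  by apply: maxnorm_le => // s sT; exact: xu.
by rewrite distrC (le_trans (xu _ _ tT))// ltW.
Qed.
End kernels.

(** * Solutions of the multipoint problem and stability of well-posedness *)

Section multipoint.
Context {R : realType} {n m : nat} (T : R) (tt : 'I_m.+1 -> R)
  (B : 'I_m.+1 -> 'M[R]_n) (A : R -> 'M[R]_n).
Hypothesis T0 : 0 <= T.
Notation mu := (@lebesgue_measure R).

(** The equation involves the integral term and the right-hand side only through their sum, so a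
    part of the kernel can be moved into the right-hand side. *)
Lemma is_solution_change I J (f g x : R -> 'cV[R]_n) d :
  (forall t, t \in `]0, T[ -> I x t + f t = J x t + g t) ->
  is_solution T tt B A I f d x -> is_solution T tt B A J g d x.
Proof.
move=> IJ [cx dx cdx ex bx]; split => // t tT.
by rewrite ex// -!addrA IJ.
Qed.

Lemma is_solutionB K (f g x y : R -> 'cV[R]_n) d e : continuous_kernel T K ->
  is_solution T tt B A (kernel_term T K) f d x ->
  is_solution T tt B A (kernel_term T K) g e y ->
  is_solution T tt B A (kernel_term T K) (f - g) (d - e) (x - y).
Proof.
move=> cK [cx dx cdx ex bx] [cy dy cdy ey b_y].
have D t : t \in `]0, T[ -> derive1 (x - y) t = derive1 x t - derive1 y t.
  by move=> tT; rewrite !derive1E deriveB//; [exact: dx|exact: dy].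
split.
- exact: within_continuousB.
- by move=> t tT; apply: derivableB; [exact: dx|exact: dy].
- apply: (@subspace_eq_continuous _ _ _ (derive1 x - derive1 y)).
    by move=> t; rewrite inE => tT; exact/esym/D.
  exact: within_continuousB.
- move=> t tT; rewrite D// ex// ey// kernel_termB//; last first.
    exact: subset_itv_oo_cc.
  by rewrite mulmxBr; apply/colP => i; rewrite !mxE; ring.
- rewrite -bx -b_y -sumrB; apply: eq_bigr => i _.
  by rewrite -mulmxBr.
Qed.

(** Solutions are continuous, so agreement of the two integral terms on continuous functions
    suffices. It serves to pass between [degenerate_term] and [kernel_term]. *)
Lemma well_posed_with_eq I J C :
  (forall x t, {within `[0, T], continuous x} -> t \in `]0, T[ -> I x t = J x t) ->
  well_posed_with T tt B A I C -> well_posed_with T tt B A J C.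
Proof.
move=> IJ wp f d cf; have [x [sx ux nx]] := wp f d cf.
exists x; split => //.
  by apply: is_solution_change (sx) => t tT; rewrite IJ//; case: sx.
move=> y sy; apply: ux; apply: is_solution_change (sy) => t tT.
by rewrite IJ//; case: sy.
Qed.

(** Tested on constant data [f = d = v] with all entries of [v] equal to 1. For [n = 0] all norms
    vanish and the estimate says nothing about [C]. *)
Lemma well_posed_with_ge0 I C : (0 < n)%N -> well_posed_with T tt B A I C -> 0 <= C.
Proof.
move=> n0 wp; pose v : 'cV[R]_n := const_mx 1.
have v0 : 0 < `|v|.
  by rewrite (lt_le_trans _ (mx_norm_entry v (Ordinal n0) 0))// mxE normr1.
have cv : {within `[0, T], continuous (cst v : R -> 'cV[R]_n)}.
  exact/continuous_subspaceT/cst_continuous.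
have [x [[cx _ _ _ _] _ +]] := wp (cst v) v cv.
rewrite maxnorm_cst// maxxx => /(le_trans (maxnorm_ge0 T0 cx)).
by rewrite pmulr_lge0.
Qed.

Lemma well_posed_with_perturbation K1 K2 (C delta : R) :
  continuous_kernel T K1 -> continuous_kernel T K2 -> 0 <= C ->
  (forall t, t \in `[0, T] ->
    \int[mu]_(s in `[0, T]) opnorm (K2 t s - K1 t s) <= delta) ->
  C * delta < 1 ->
  well_posed_with T tt B A (kernel_term T K1) C ->
  well_posed_with T tt B A (kernel_term T K2) (C / (1 - C * delta)).
Proof.
move=> cK1 cK2 C0 Kdelta Cdelta wp f d cf.
pose q : R := C * delta.
have delta0 : 0 <= delta.
  rewrite (le_trans _ (Kdelta 0 _)) ?in_itv/= ?lexx//.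
  by apply: Rintegral_ge0 => s _; exact: opnorm_ge0.
have q0 : 0 <= q by exact: mulr_ge0.
have cL := continuous_kernelB cK2 cK1.
pose L x := kernel_term T (fun t s => K2 t s - K1 t s) x.
have cLx x : {within `[0, T], continuous x} -> {within `[0, T], continuous (L x)}.
  exact: kernel_term_continuous.
have LE x t : {within `[0, T], continuous x} -> t \in `[0, T] ->
    L x t = kernel_term T K2 x t - kernel_term T K1 x t.
  by move=> cx tT; exact: kernel_term_kernelB.
have normL x : {within `[0, T], continuous x} ->
    maxnorm T (L x) <= delta * maxnorm T x.
  move=> cx; apply: maxnorm_le => // t tT.
  rewrite (le_trans (norm_vint_mulmx (continuous_kernel_section cL tT) cx))//.
  by rewrite ler_wpM2r ?maxnorm_ge0// Kdelta.
(* [S] is the solution operator of the [K1]-problem for the fixed [d]. Continuity is a premise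
   inside the choice, with 0 as dummy value for discontinuous [g]. *)
have /choice[S SP] : forall g, exists x, {within `[0, T], continuous g} ->
    [/\ is_solution T tt B A (kernel_term T K1) g d x,
        forall y, is_solution T tt B A (kernel_term T K1) g d y ->
          {in `[0, T], y =1 x}
      & maxnorm T x <= C * Num.max (maxnorm T g) `|d|].
  move=> g; have [cg|ncg] := pselect {within `[0, T], continuous g}; last first.
    by exists 0.
  by have [x xP] := wp g d cg; exists x.
have S_lip g h : {within `[0, T], continuous g} -> {within `[0, T], continuous h} ->
    maxnorm T (S g - S h) <= C * maxnorm T (g - h).
  move=> cg ch; have [sg _ _] := SP g cg; have [sh _ _] := SP h ch.
  (* The difference solves the [K1]-problem with data [g - h] and 0. By uniqueness it is the
     solution for which the estimate with constant [C] holds. *)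
  have := is_solutionB cK1 sg sh; rewrite subrr => sgh.
  have cgh : {within `[0, T], continuous (g - h)} by exact: within_continuousB.
  have [z [_ uz]] := wp (g - h) 0 cgh.
  by rewrite normr0 max_l ?maxnorm_ge0// (eq_maxnorm (uz _ sgh)).
have cS g : {within `[0, T], continuous g} -> {within `[0, T], continuous (S g)}.
  by move=> /SP[[]].
have cfL x : {within `[0, T], continuous x} ->
    {within `[0, T], continuous (f + L x)}.
  by move=> cx; apply: within_continuousD => //; exact: cLx.
pose Phi x := S (f + L x).
have Phi_lip x y : {within `[0, T], continuous x} -> {within `[0, T], continuous y} ->
    maxnorm T (Phi x - Phi y) <= q * maxnorm T (x - y).
  move=> cx cy; rewrite (le_trans (S_lip _ _ (cfL _ cx) (cfL _ cy)))//.
  have cxy : {within `[0, T], continuous (x - y)} by exact: within_continuousB.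
  rewrite -mulrA ler_wpM2l// (le_trans _ (normL _ cxy))// le_eqVlt.
  rewrite opprD addrACA subrr add0r.
  apply/orP; left; apply/eqP/eq_maxnorm => t tT.
  by rewrite [RHS]kernel_termB.
have [x cx Phix] : exists2 x, {within `[0, T], continuous x} & {in `[0, T], Phi x =1 x}.
  apply: (@sup_contraction_fixpoint _ _ _ T0 _ q) => //; first by rewrite q0.
  by move=> x cx; exact/cS/cfL.
(* The solution is taken to be [Phi x]: it satisfies the [K1]-equation by construction, while [x] is
   only known to agree with it on [[0, T]]. *)
pose z := Phi x.
have cz : {within `[0, T], continuous z} by exact/cS/cfL.
have Lz : {in `[0, T], L x =1 L z}.
  by move=> t tT; apply: eq_kernel_term => s sT; exact/esym/Phix.
have [sz _ nz] := SP _ (cfL _ cx).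
have oo_cc t : t \in `]0, T[ -> t \in `[0, T] by exact: subset_itv_oo_cc.
exists z; split.
- apply: is_solution_change sz => t /oo_cc tT.
  by rewrite fctE Lz// LE// addrCA subrKC addrC.
(* A [K2]-solution [y] solves the [K1]-problem with right-hand side [f + L y], hence is a fixed
   point of [Phi] on [[0, T]], and the contraction leaves only [x]. *)
- move=> y sy; have cy : {within `[0, T], continuous y} by case: sy.
  have yPhi : {in `[0, T], y =1 Phi y}.
    have [_ uy _] := SP _ (cfL _ cy); apply: uy.
    apply: is_solution_change sy => t /oo_cc tT.
    by rewrite fctE LE// addrCA subrKC addrC.
  have cyx : {within `[0, T], continuous (y - x)} by exact: within_continuousB.
  have yx0 : maxnorm T (y - x) <= 0.
    have := Phi_lip y x cy cx.
    rewrite (@eq_maxnorm _ _ _ (Phi y - Phi x) (y - x)); last first.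
      by move=> t tT; rewrite !fctE -yPhi// Phix.
    move: Cdelta; rewrite -/q; set N := maxnorm _ _ => q1 Nq; rewrite leNgt.
    by apply/negP => N0; move: Nq; rewrite leNgt -ltr_pdivlMr// divff ?gt_eqF// q1.
  move=> t tT; rewrite /z Phix//; apply/eqP; rewrite -subr_eq0 -normr_le0.
  exact: le_trans (le_maxnorm cyx tT) yx0.
- have zx : maxnorm T z = maxnorm T x by exact: eq_maxnorm.
  (* With [N] the norm of [z] and [D] the larger of the norms of [f] and [d], the [K1]-estimate
     gives [N <= C * (D + delta * N)]; solving for [N] yields the new constant. *)
  rewrite -/q mulrAC ler_pdivlMr ?subr_gt0// mulrBr mulr1 lerBlDr.
  rewrite (le_trans nz)// /q [_ * (C * _)]mulrCA -mulrDr ler_wpM2l//.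
  have M0 : 0 <= maxnorm T z * delta by rewrite mulr_ge0// maxnorm_ge0.
  rewrite ge_max; apply/andP; split.
    rewrite (le_trans (maxnormD T0 cf (cLx _ cx)))// lerD ?le_max ?lexx//.
    by rewrite zx mulrC normL.
  rewrite (le_trans _ (_ : Num.max (maxnorm T f) `|d| <= _)) ?lerDl//.
  by rewrite le_max lexx orbT.
Qed.
End multipoint.

(** * Uniform approximation of a continuous kernel by degenerate ones *)

Section approximation.
Context {R : realType} (T : R).
Hypothesis T0 : 0 <= T.

(** Hat functions of radius [d] around the multiples of [d] in the segment, divided by their sum. *)
Lemma partition_of_unity (d : R) : 0 < d ->
  exists (k : nat) (p : 'I_k -> R) (a : 'I_k -> R -> R),
    [/\ (0 < k)%N, forall j, p j \in `[0, T],
        forall j, {within `[0, T], continuous (a j)}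
      & forall t, t \in `[0, T] ->
          [/\ \sum_(j < k) a j t = 1, forall j, 0 <= a j t
            & forall j, a j t != 0 -> `|t - p j| < d]].
Proof.
move=> d0; pose k := (Num.truncn (T / d)).+1.
pose p (j : 'I_k) : R := Num.min T (j%:R * d).
(* twice the hat function max(0, d - |t - p_j|) *)
pose w (j : 'I_k) (t : R) : R := d - `|t - p j| + `|d - `|t - p j| |.
have w0 j t : 0 <= w j t.
  by have := ler_norm (- (d - `|t - p j|)); rewrite normrN /w; lra.
have wp j t : (0 < w j t) = (`|t - p j| < d).
  rewrite /w; have [|] := ltP `|t - p j| d => h.
    by rewrite ltr_wpDr// subr_gt0.
  by rewrite (@ler0_norm _ (d - _)) ?subr_le0// subrr ltxx.
pose W t := \sum_(j < k) w j t.
(* The node with index [j = truncn (t / d)] satisfies [j * d <= t < (j + 1) * d], so its hat is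
   positive at [t]; [k] is large enough to include this index for every [t <= T]. *)
have W0 t : t \in `[0, T] -> 0 < W t.
  rewrite in_itv/= => /andP[t0 tT].
  have td : 0 <= t / d by rewrite divr_ge0// ltW.
  have jk : (Num.truncn (t / d) < k)%N.
    by rewrite ltnS le_truncn// ler_pM2r ?invr_gt0.
  rewrite /W (bigD1 (Ordinal jk))//= ltr_pwDl ?sumr_ge0// wp /p/=.
  have /andP[] := truncn_itv td.
  rewrite ler_pdivlMr// ltr_pdivrMr// -natr1 mulrDl mul1r => jt tj.
  rewrite min_r ?(le_trans jt)// ger0_norm ?subr_ge0//; lra.
have cw j : continuous (w j).
  move=> t; have ct : (`|s - p j| @[s --> t] --> `|t - p j|).
    by apply: (@cvg_norm _ R^o); apply: (@cvgB _ R^o); [exact: cvg_id|exact: cvg_cst].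
  have cdt : (d - `|s - p j| @[s --> t] --> d - `|t - p j|).
    by apply: (@cvgB _ R^o) => //; exact: cvg_cst.
  by apply: (@cvgD _ R^o) => //; exact: (@cvg_norm _ R^o).
exists k, p, (fun j t => w j t / W t); split => //.
- move=> j; rewrite in_itv/= ge_min lexx andbT le_min T0/= mulr_ge0//.
  exact: ltW.
- move=> j; apply/subspace_continuousP => t tT; apply: cvgM.
    by apply: cvg_within_filter; exact: cw.
  apply: cvgV; first by rewrite gt_eqF// W0.
  have /subspace_continuousP := @within_continuous_sum R R `[0, T]%classic
    R^o _ (index_enum _) w (fun j => continuous_subspaceT (cw j)).
  exact.
- move=> t tT; split.
  + by rewrite -mulr_suml divff// gt_eqF// W0.
  + by move=> j; rewrite divr_ge0// ltW// W0.
  + move=> j; rewrite mulf_eq0 negb_or => /andP[wj _].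
    by rewrite -wp lt_neqAle eq_sym wj w0.
Qed.

Lemma degenerate_approximation n (K : R -> R -> 'M[R]_n) (eta : R) :
  continuous_kernel T K -> 0 < eta ->
  exists (k : nat) (phi psi : 'I_k -> R -> 'M[R]_n),
    [/\ (0 < k)%N, forall j, {within `[0, T], continuous (phi j)},
        forall j, {within `[0, T], continuous (psi j)}
      & forall t s, t \in `[0, T] -> s \in `[0, T] ->
          `|K t s - \sum_(j < k) phi j t *m psi j s| <= eta].
Proof.
move=> cK eta0.
have cD : compact (`[0, T] `*` `[0, T] : set (R * R)).
  by apply: compact_setX; exact: segment_compact.
have [d d0 dP] := compact_unif_continuous cD cK eta0.
have [k [p [a [k0 pT ca aP]]]] := partition_of_unity d0.
(* The scalar weights enter as multiples of the identity matrix. *)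
exists k, (fun j t => a j t *: 1%:M), (fun j => K (p j)); split => //.
- by move=> j t; apply: cvgZr_tmp; exact: ca.
- by move=> j; apply: continuous_kernel_section.
move=> t s tT sT; have [a1 a_ge0 ap] := aP t tT.
(* As the weights sum to 1, the error is a convex combination of [K t s - K (p j) s], where a
   nonzero weight forces [t] to be within [d] of [p j]. *)
have -> : K t s - \sum_(j < k) (a j t *: 1%:M) *m K (p j) s =
    \sum_(j < k) a j t *: (K t s - K (p j) s).
  under [RHS]eq_bigr do rewrite scalerBr.
  rewrite sumrB -scaler_suml a1 scale1r; congr (_ - _).
  by apply: eq_bigr => j _; rewrite -scalemxAl mul1mx.
rewrite (le_trans (ler_norm_sum _ _ _))// -[leRHS]mul1r -a1 mulr_suml.
apply: ler_sum => j _; rewrite normrZ ger0_norm//.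
have [->|aj] := eqVneq (a j t) 0; first by rewrite !mul0r.
rewrite ler_wpM2l// ltW//; apply: (dP (t, s) (p j, s)); split => //=.
  exact: ap.
exact: ballxx.
Qed.

End approximation.

Unset Implicit Arguments.

Theorem theorem4p3 (R : realType) (T : R) (n m : nat)
    (tt : 'I_m.+1 -> R) (A : R -> 'M[R]_n) (K : R -> R -> 'M[R]_n)
    (B : 'I_m.+1 -> 'M[R]_n)
    (T_gt0 : 0 < T) (n_gt0 : (0 < n)%N) (m_gt0 : (0 < m)%N)
    (tt_first : tt ord0 = 0) (tt_last : tt ord_max = T)
    (tt_incr : forall i j : 'I_m.+1, (i < j)%N -> tt i < tt j)
    (A_cont : {within `[0, T], continuous A})
    (K_cont : {within `[0, T] `*` `[0, T], continuous (fun p : R * R => K p.1 p.2)}) :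
  well_posed T tt B A (kernel_term T K) <->
  exists (eps : R) (k : nat) (phi psi : 'I_k -> R -> 'M[R]_n) (Ck : R),
    [/\ 0 < eps, (0 < k)%N,
        forall j, {within `[0, T], continuous (phi j)} /\
                  {within `[0, T], continuous (psi j)},
        kernel_distance T K phi psi < eps
      & well_posed_with T tt B A (degenerate_term T phi psi) Ck
        /\ Ck * eps < 1].
Proof.
have T0 := ltW T_gt0.
have oo_cc t : t \in `]0, T[ -> t \in `[0, T] by exact: subset_itv_oo_cc.
split=> [[C wp]|[eps [k [phi [psi [Ck [eps0 k0 cpp dK [wp Ceps]]]]]]]].
- have C0 := well_posed_with_ge0 T0 n_gt0 wp.
  (* This gives [C * delta < 1 / 4]. The perturbed constant times [2 * delta] is then below
     [(1 / 2) / (3 / 4) = 2 / 3]. *)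
  pose delta : R := (4 * (C + 1))^-1.
  have delta0 : 0 < delta by rewrite invr_gt0 mulr_gt0// ltr_wpDl.
  have Cdelta : C * delta < 1 / 4.
    rewrite /delta invfM mulrCA mul1r gtr_pMr// ltr_pdivrMr ?ltr_wpDl//.
    by rewrite mul1r ltrDl.
  (* Passing from the entrywise norm to [opnorm] costs a factor [n], integrating over the segment a
     factor [T]. *)
  pose eta := delta / (n%:R * T).
  have nT : 0 < n%:R * T by rewrite mulr_gt0// ltr0n.
  have [k [phi [psi [k0 cphi cpsi approx]]]] :=
    degenerate_approximation T0 K_cont (divr_gt0 delta0 nT).
  have cdeg := degenerate_kernel_continuous cphi cpsi.
  have int_le t : t \in `[0, T] -> \int[lebesgue_measure]_(s in `[0, T])
      opnorm (K t s - \sum_(j < k) phi j t *m psi j s) <= delta.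
    move=> tT; have -> : delta = n%:R * eta * T.
      by rewrite /eta; field; rewrite gt_eqF// gt_eqF// ltr0n.
    apply: Rintegral_itv_le => //.
      apply: within_continuous_opnorm.
      exact: (continuous_kernel_section (continuous_kernelB K_cont cdeg)).
    move=> s sT; rewrite (le_trans (opnorm_le_mx_norm _))// ler_wpM2l//.
    exact: approx.
  (* The integrals are only known to be at most [delta]; doubling makes the required inequality
     strict. *)
  exists (2 * delta), k, phi, psi, (C / (1 - C * delta)); split => //.
  + by rewrite mulr_gt0.
  + rewrite (@le_lt_trans _ _ delta) ?ltr_pMl ?ltr1n//.
    apply: ge_sup => [|_ [t tT <-]]; last exact: int_le.
    by eexists; exists 0; rewrite //= in_itv/= lexx.
  split.
    apply: (@well_posed_with_eq _ _ _ _ _ _ _ (kernel_term T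
      (fun t s => \sum_(j < k) phi j t *m psi j s))).
      by move=> x t cx tT; rewrite degenerate_termE// oo_cc.
    apply: (well_posed_with_perturbation T0 K_cont cdeg C0 _ _ wp); last lra.
    by move=> t tT; under eq_Rintegral do rewrite -opnormN opprB; exact: int_le.
  rewrite mulrAC ltr_pdivrMr; lra.
- have Ck0 := well_posed_with_ge0 T0 n_gt0 wp.
  have cphi j := (cpp j).1; have cpsi j := (cpp j).2.
  (* Now the degenerate kernel is perturbed to [K], with [kernel_distance] as the size of the
     perturbation; nonnegativity of [Ck] carries its bound by [eps] over to the product. *)
  eexists; apply: (well_posed_with_perturbation T0
    (degenerate_kernel_continuous cphi cpsi) K_cont Ck0
    (fun t tT => le_kernel_distance T0 cphi cpsi K_cont tT)).
    by rewrite (le_lt_trans _ Ceps)// ler_wpM2l// ltW.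
  apply: well_posed_with_eq wp => x t cx tT.
  by rewrite degenerate_termE// oo_cc.
Qed.
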